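(* Let $Y=(Y_t)_{t\ge0}$, $L=(L_t)_{t\ge0}$ and $U=(U_t)_{t\ge0}$ be real-valued rcll $(\mathcal{F}_t)$-adapted processes such that $L_0\le Y_0\le U_0$ and such that there exists a (deterministic) $\varepsilon>0$ with $U_t-L_t>\varepsilon$ for all $t\in[0,+\infty)$. Then the Skorokhod problem $SPR(Y,L,U)$ on $[0,+\infty)$ has a unique solution $(X,K^+,K^-)$.
   Context: Fix a probability space $(\Omega,\mathcal{F},\mathbb{P})$ with a filtration $(\mathcal{F}_t)_{t\ge0}$ satisfying the usual conditions (completeness and right continuity). ''rcll'' means right continuous with left limits. Equalities and inequalities between processes are understood $\mathbb{P}$-a.s. Definition. For rcll adapted processes $Y,L,U$ with $L\le U$ and $L_0\le Y_0\le U_0$, a triplet of processes $(X,K^+,K^-)$ is a solution of the Skorokhod problem $SPR(Y,L,U)$ on $[0,+\infty)$ if $K^+$ and $K^-$ are rcll, adapted, nonnegative (finite-valued), increasing (i.e. nondecreasing) processes with $K^+_0=K^-_0=0$ and: (1) $X_t=Y_t+K^+_t-K^-_t$ for all $t\ge0$; (2) $L_t\le X_t\le U_t$ for all $t\ge0$; (3) $\int_0^{T} (X_s-L_s)\,dK^+_s=\int_0^{T} (U_s-X_s)\,dK^-_s=0$ for every $T>0$, the integrals being pathwise Stieltjes integrals with respect to the increasing processes $K^+$ and $K^-$. Uniqueness is understood up to indistinguishability of each of $X,K^+,K^-$. *)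

(* Defs.v *)
From HB Require Import structures.
From mathcomp Require Import all_boot all_order all_algebra.
From mathcomp Require Import all_classical all_reals all_analysis.

Set Implicit Arguments.
Unset Strict Implicit.
Unset Printing Implicit Defensive.

Import Order.TTheory GRing.Theory Num.Theory.
Import numFieldNormedType.Exports.

Local Open Scope classical_set_scope.
Local Open Scope ring_scope.

(* Time is [0, +oo), encoded as the nonnegative elements of R; the values of
   paths and filtrations at negative times are never constrained or used. *)

Section filtrations.
Context {R : realType} {d : measure_display} {T : measurableType d}.

Definition filtration (F : R -> set_system T) : Prop :=
  [/\ forall t, 0 <= t -> sigma_algebra setT (F t),
      forall t, 0 <= t -> F t `<=` measurable &
      forall s t, 0 <= s -> s <= t -> F s `<=` F t].

(* [P.-negligible N] means that N is included in a measurable P-null set, so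
   the completeness clause also makes the underlying space complete. *)
Definition usual_conditions (P : probability T R) (F : R -> set_system T) :
    Prop :=
  [/\ forall N, P.-negligible N -> F 0 N &
      forall t, 0 <= t -> \bigcap_(s in [set s | t < s]) F s = F t].

Definition adapted (F : R -> set_system T) (X : R -> T -> R) : Prop :=
  forall t, 0 <= t -> forall B : set R, measurable B -> F t (X t @^-1` B).

End filtrations.

Section paths.
Context {R : realType}.

Definition rcll_path (x : R -> R) : Prop :=
  (forall t, 0 <= t -> x @ t^'+ --> x t) /\
  (forall t, 0 < t -> cvg (x @ t^'-)).

Definition nondecreasing_path (k : R -> R) : Prop :=
  forall s t, 0 <= s -> s <= t -> k s <= k t.

(* \int_0^b f dk = v, for a path k on [0, +oo) that is nondecreasing and
   right-continuous; [cumulative R R] requires a function on the whole line, so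
   k is extended by k 0 on the left of 0. The extension puts no mass at 0, so
   that integrating on [0, b] or on (0, b] is the same. *)
Definition is_stieltjes_integral (f k : R -> R) (b : R) (v : \bar R) : Prop :=
  exists2 c : cumulative R R,
    forall t, c t = k (Num.max 0 t) &
    (\int[lebesgue_stieltjes_measure c]_(s in `[0%R, b]) (f s)%:E = v)%E.

End paths.

Section processes.
Context {R : realType} {d : measure_display} {T : measurableType d}.
Context {P : probability T R}.

Definition rcll (X : R -> {RV P >-> R}) : Prop :=
  forall w, rcll_path (X ^~ w).

Definition indistinguishable (X Y : R -> {RV P >-> R}) : Prop :=
  {ae P, forall w, forall t, 0 <= t -> X t w = Y t w}.

Definition increasing_process (F : R -> set_system T)
    (K : R -> {RV P >-> R}) : Prop :=
  [/\ rcll K, adapted F K,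
      {ae P, forall w, K 0 w = 0},
      {ae P, forall w, forall t, 0 <= t -> 0 <= K t w} &
      {ae P, forall w, nondecreasing_path (K ^~ w)}].

Definition skorokhod_solution (F : R -> set_system T)
    (Y L U X Kp Km : R -> {RV P >-> R}) : Prop :=
  [/\ increasing_process F Kp /\ increasing_process F Km,
      {ae P, forall w, forall t, 0 <= t -> X t w = Y t w + Kp t w - Km t w},
      {ae P, forall w, forall t, 0 <= t -> L t w <= X t w <= U t w} &
      {ae P, forall w, forall b, 0 < b ->
        is_stieltjes_integral (fun s => X s w - L s w) (Kp ^~ w) b 0%E /\
        is_stieltjes_integral (fun s => U s w - X s w) (Km ^~ w) b 0%E}].

End processes.

(* Main.v *)
Require Import Defs.
From HB Require Import structures.
From mathcomp Require Import all_boot all_order all_algebra.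
From mathcomp Require Import all_classical all_reals all_analysis.
From mathcomp Require Import measurable_realfun lra.

(* Existence: put a = L - Y and b = Y - U, and let M f t be the maximum of 0 and
   of f over [0, t].  A solution is a fixed point of K+ = M (a + K-),
   K- = M (b + K+), because K = M f only moves when K = f.  The Picard iterates
   from (0, 0) are adapted and increase.  On an interval on which a and b
   oscillate by at most eps/2, the process starts at distance at least eps/2
   from one of the two barriers, and the pushing at that barrier does not move
   at all; hence the iterates become stationary after finitely many steps on
   each bounded interval, because rcll paths have finitely many large
   oscillations there.

   Uniqueness: the integral conditions say that K+ is flat around each t with
   X t > L t, and K- around each t with X t < U t.  While X > X', the processes
   K+ and K-' are thus flat, so X - X' decreases; hence X = X'.  Since L < U, at
   each time K+ and K+' are both flat or K- and K-' are both flat, so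
   K+ - K+' = K- - K-' is constant. *)

Set Implicit Arguments.
Unset Strict Implicit.
Unset Printing Implicit Defensive.

Import Order.TTheory GRing.Theory Num.Theory.
Import numFieldNormedType.Exports.

Local Open Scope classical_set_scope.
Local Open Scope ring_scope.

(** * Paths and running maxima *)

Section real_paths.
Context {R : realType}.
Implicit Types (x y f g k a b : R -> R) (s t e h : R).

(** If [Q] failed somewhere, the times at which it holds would have a supremum; the last clause
    gives [Q] there, and the one before it goes beyond. *)
Lemma real_induction (Q : R -> Prop) :
  (forall s t, 0 <= s -> s <= t -> Q t -> Q s) -> Q 0 ->
  (forall t, 0 <= t -> Q t -> exists2 t', t < t' & Q t') ->
  (forall t, 0 < t -> (forall s, 0 <= s < t -> Q s) -> Q t) ->
  forall t, 0 <= t -> Q t.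
Proof.
move=> Qle Q0 Qr Ql t t0; apply: contrapT => nQt.
pose S := [set s | 0 <= s /\ Q s].
have St : ubound S t.
  move=> s [s0 Qs]; rewrite leNgt; apply/negP => ts; apply: nQt.
  exact: Qle (ltW ts) Qs.
have hS : has_sup S by split; [exists 0 | exists t].
have S0 : 0 <= sup S by exact: ub_le_sup hS.2 _ _.
have Qlt s : 0 <= s < sup S -> Q s.
  move=> /andP[s0 ss].
  have [r [r0 Qr'] sr] : exists2 r, S r & s < r.
    have d0 : 0 < sup S - s by rewrite subr_gt0.
    by have [r Sr] := sup_adherent d0 hS; rewrite subKr => ?; exists r.
  exact: Qle (ltW sr) Qr'.
have QS : Q (sup S).
  by move: S0; rewrite le_eqVlt => /predU1P[<-//|S0]; exact: Ql.
have [t' St' Qt'] := Qr _ S0 QS.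
have : t' <= sup S.
  by apply: ub_le_sup hS.2 _ _; split => //; exact: le_trans S0 (ltW St').
by rewrite leNgt St'.
Qed.

(** [Q] need not be inherited by earlier times: [real_induction] is applied to the validity of [Q]
    on [0, t), which passes to limits by itself. *)
Lemma real_induction_pt (Q : R -> Prop) :
  (forall t, 0 <= t -> (forall s, 0 <= s < t -> Q s) ->
    exists2 h, 0 < h & forall s, t <= s < t + h -> Q s) ->
  forall t, 0 <= t -> Q t.
Proof.
move=> Qstep t t0; suff : forall s, 0 <= s < t + 1 -> Q s.
  by apply; rewrite t0 ltrDl ltr01.
apply: (@real_induction (fun t => forall s, 0 <= s < t -> Q s)).
- move=> r r' r0 rr' H s /andP[s0 sr]; apply: H.
  by rewrite s0 (lt_le_trans sr).
- by move=> s; case: ltgtP.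
- move=> r r0 H; have [h h0 Hh] := Qstep _ r0 H.
  exists (r + h); first by rewrite ltrDl.
  move=> s /andP[s0 srh]; case: (ltP s r) => sr; first by apply: H; rewrite s0.
  by apply: Hh; rewrite sr.
- move=> r r0 H s /andP[s0 sr].
  have [m1 m2] := midf_lt sr.
  apply: (H ((s + r) / 2)); last by rewrite s0.
  by rewrite m2 andbT (le_trans s0 (ltW m1)).
- by rewrite addr_ge0.
Qed.

Lemma near_right_itv t (A : set R) :
  (\forall s \near t^'+, A s) -> A t ->
  exists2 h, 0 < h & forall s, t <= s < t + h -> A s.
Proof.
move=> [h /= h0 hA] At; exists h => // s /andP[ts sth].
move: ts; rewrite le_eqVlt => /predU1P[<-//|ts].
by apply: hA => //=; rewrite ltr0_norm ?subr_lt0// opprB ltrBlDl.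
Qed.

Lemma near_left_itv t (A : set R) : 0 < t ->
  (\forall s \near t^'-, A s) ->
  exists2 r, 0 <= r < t & forall s, r <= s < t -> A s.
Proof.
move=> t0 [h /= h0 hA]; exists (Num.max 0 (t - h / 2)).
  by rewrite le_max lexx/= gt_max t0/= ltrBlDr ltrDl divr_gt0.
move=> s; rewrite ge_max => /andP[/andP[s0 ths] st].
apply: hA => //=; rewrite gtr0_norm ?subr_gt0//.
rewrite ltrBlDr -ltrBlDl; apply: lt_le_trans ths.
by rewrite ltrD2l ltrN2 ltr_pdivrMr// ltr_pMr// ltr1n.
Qed.

Lemma rcll_path_right x t e : rcll_path x -> 0 <= t -> 0 < e ->
  exists2 h, 0 < h & forall s, t <= s < t + h -> `|x s - x t| <= e.
Proof.
move=> [xr _] t0 e0; have /cvgrPdist_le/(_ _ e0) xe := xr _ t0.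
apply: (near_right_itv (A := fun s => `|x s - x t| <= e)); last first.
  by rewrite subrr normr0 ltW.
by near do rewrite distrC.
Unshelve. all: by end_near. Qed.

Lemma rcll_path_left x t e : rcll_path x -> 0 < t -> 0 < e ->
  exists2 r, 0 <= r < t & forall s s', r <= s < t -> r <= s' < t ->
    `|x s - x s'| <= e.
Proof.
move=> [_ xl] t0 e0.
have e20 : 0 < e / 2 by rewrite divr_gt0.
have /cvg_ex[/= l /cvgrPdist_le/(_ _ e20) xe] := xl _ t0.
have [r rt H] := near_left_itv t0 xe.
exists r => // s s' /H ls /H ls'.
rewrite (splitr e) -(subrK l (x s)) -addrA (le_trans (ler_normD _ _))//.
by rewrite lerD// distrC.
Qed.

Lemma rcll_path_eq x y : (forall t, 0 <= t -> x t = y t) ->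
  rcll_path x -> rcll_path y.
Proof.
move=> xy [xr xl]; split=> t t0.
  rewrite -xy//; apply: cvg_trans (xr _ t0); apply: near_eq_cvg.
  near=> s; apply/xy/(le_trans t0); near: s; exact: nbhs_right_ge.
rewrite (_ : cvg _ = cvg (x @ t^'-)); first exact: xl.
have xyn : \forall s \near t^'-, x s = y s.
  near=> s; apply: xy; near: s; exact: nbhs_left_ge.
rewrite propeqE; split => /cvg_ex[l H]; apply/cvg_ex; exists l;
  apply: cvg_trans H; apply: near_eq_cvg => //.
by near do apply/esym.
Unshelve. all: by end_near. Qed.

Lemma rcll_pathD x y : rcll_path x -> rcll_path y ->
  rcll_path (fun t => x t + y t).
Proof.
move=> [xr xl] [yr yl]; split=> t t0; first exact: cvgD (xr _ t0) (yr _ t0).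
exact: is_cvgD (xl _ t0) (yl _ t0).
Qed.

Lemma rcll_pathB x y : rcll_path x -> rcll_path y ->
  rcll_path (fun t => x t - y t).
Proof.
move=> [xr xl] [yr yl]; split=> t t0; first exact: cvgB (xr _ t0) (yr _ t0).
exact: is_cvgB (xl _ t0) (yl _ t0).
Qed.

Lemma rcll_path_cst (c : R) : rcll_path (fun=> c).
Proof. by split=> t t0; [exact: cvg_cst|exact: is_cvg_cst]. Qed.

(** Monotone bounded functions have left limits, so only growth to the right of each time has to be
    controlled. *)
Lemma nondecreasing_rcll_path k : nondecreasing_path k ->
  (forall t e, 0 <= t -> 0 < e ->
    exists2 h, 0 < h & forall s, t <= s < t + h -> k s <= k t + e) ->
  rcll_path k.
Proof.
move=> ndk kr; split=> t t0.
  apply/cvgrPdist_le => e e0; have [h h0 H] := kr _ _ t0 e0.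
  near=> s.
  have ts : t <= s by near: s; exact: nbhs_right_ge.
  rewrite distrC ger0_norm ?subr_ge0 ?ndk// lerBlDl H// ts/=.
  by near: s; apply: nbhs_right_lt; rewrite ltrDl.
apply: nondecreasing_at_left_is_cvgr.
  near=> r => s s'; rewrite !in_itv/= => /andP[rs _] _ ss'; apply: ndk => //.
  by apply: le_trans (ltW rs); near: r; exact: nbhs_left_ge.
near=> r; exists (k t) => _ [s /=+ <-]; rewrite in_itv/= => /andP[rs st].
apply: ndk; last exact: ltW.
by apply: le_trans (ltW rs); near: r; exact: nbhs_left_ge.
Unshelve. all: by end_near. Qed.

(** Replaces a finite partition of [0, t] into intervals of small oscillation. These are half-open,
    since a jump at [t'] may have any size; in the applications [Q t] therefore concerns times
    before [t]. *)
Lemma rcll_path_induction x y e (Q : R -> Prop) : 0 < e ->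
  rcll_path x -> rcll_path y ->
  (forall s t, 0 <= s -> s <= t -> Q t -> Q s) -> Q 0 ->
  (forall t t', 0 <= t -> t < t' -> Q t ->
    (forall s, t <= s < t' -> `|x s - x t| <= e /\ `|y s - y t| <= e) ->
    Q t') ->
  forall t, 0 <= t -> Q t.
Proof.
move=> e0 rx ry Qle Q0 Qstep; apply: real_induction => // t t0.
  move=> Qt; have [h h0 H] := rcll_path_right rx t0 e0.
  have [h' h'0 H'] := rcll_path_right ry t0 e0.
  have m0 : 0 < Num.min h h' by rewrite lt_min h0.
  exists (t + Num.min h h'); first by rewrite ltrDl.
  apply: Qstep Qt _ => //; first by rewrite ltrDl.
  move=> s /andP[ts stm]; split; [apply: H|apply: H']; rewrite ts/=;
    by rewrite (lt_le_trans stm)// lerD2l ge_min lexx ?orbT.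
move=> Qs; have [r /andP[r0 rt] H] := rcll_path_left rx t0 e0.
have [r' /andP[r'0 r't] H'] := rcll_path_left ry t0 e0.
have mt : Num.max r r' < t by rewrite gt_max rt.
have m0 : 0 <= Num.max r r' by rewrite le_max r0.
apply: (Qstep (Num.max r r')) => //; first by apply: Qs; rewrite m0.
move=> s /andP[ms st]; split; [apply: H|apply: H'];
  by rewrite ?mt ?le_max ?lexx ?orbT//= st (le_trans _ ms)// le_max lexx ?orbT.
Qed.

Lemma rcll_path_ubounded x : rcll_path x -> forall t, 0 <= t ->
  exists C, forall s, 0 <= s <= t -> x s <= C.
Proof.
move=> rx t t0.
suff [C HC] : exists C, forall s, 0 <= s < t + 1 -> x s <= C.
  exists C => s /andP[s0 st]; apply: HC; rewrite s0/=.
  by rewrite (le_lt_trans st)// ltrDl.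
apply: (@rcll_path_induction x x 1
  (fun t => exists C, forall s, 0 <= s < t -> x s <= C)) => //.
- move=> s' t' s'0 st' [C HC]; exists C => s /andP[s0 ss'].
  by apply: HC; rewrite s0/= (lt_le_trans ss').
- by exists 0 => s; case: ltgtP.
- move=> r r' r0 rr' [C HC] H; exists (Num.max C (x r + 1)) => s /andP[s0 sr'].
  rewrite le_max; case: (ltP s r) => sr; first by rewrite HC ?s0.
  have [] := H s _; first by rewrite sr.
  by rewrite ler_distl => /andP[_ ->]; rewrite orbT.
- by rewrite addr_ge0.
Qed.

(** The supremum need not be attained: [f] may jump down just as its left limit reaches the largest
    value. *)
Definition running_max f t : R := sup [set Num.max 0 (f s) | s in `[0, t]].

Section running_max.
Variable f : R -> R.
Hypothesis rf : rcll_path f.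

Let has_sup_running t : 0 <= t ->
  has_sup [set Num.max 0 (f s) | s in `[0, t]].
Proof.
move=> t0; split.
  by exists (Num.max 0 (f 0)), 0 => //=; rewrite in_itv/= lexx.
have [C HC] := rcll_path_ubounded rf t0.
exists (Num.max 0 C) => _ [s /=+ <-]; rewrite in_itv/= => /HC fC.
by rewrite ge_max le_max lexx/= le_max fC orbT.
Qed.

Lemma running_max_ge s t : 0 <= s <= t -> Num.max 0 (f s) <= running_max f t.
Proof.
move=> /andP[s0 st]; apply: ub_le_sup.
  by have [] := has_sup_running (le_trans s0 st).
by exists s => //=; rewrite in_itv/= s0.
Qed.

Lemma running_max_ge0 t : 0 <= t -> 0 <= running_max f t.
Proof.
move=> t0; apply: le_trans (@running_max_ge t t _); last by rewrite t0 lexx.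
by rewrite le_max lexx.
Qed.

Lemma le_running_max t : 0 <= t -> f t <= running_max f t.
Proof.
move=> t0; apply: le_trans (@running_max_ge t t _); last by rewrite t0 lexx.
by rewrite le_max lexx orbT.
Qed.

Lemma running_max_le t (C : R) : 0 <= t -> 0 <= C ->
  (forall s, 0 <= s <= t -> f s <= C) -> running_max f t <= C.
Proof.
move=> t0 C0 fC; apply: ge_sup; first by have [] := has_sup_running t0.
by move=> _ [s /=+ <-]; rewrite in_itv/= ge_max C0 => /fC ->.
Qed.

Lemma running_max_adherent t (C : R) : 0 <= t -> C < running_max f t ->
  exists2 s, 0 <= s <= t & C < Num.max 0 (f s).
Proof.
move=> t0 CM; have := sup_adherent _ (has_sup_running t0).
have d0 : 0 < running_max f t - C by rewrite subr_gt0.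
move=> /(_ _ d0)[_ [s /=+ <-]]; rewrite in_itv/= => st.
by rewrite -/(running_max _ _) subKr => ?; exists s.
Qed.

Lemma nondecreasing_running_max : nondecreasing_path (running_max f).
Proof.
move=> s t s0 st; apply: running_max_le => //.
  by apply: running_max_ge0; exact: le_trans st.
move=> r /andP[r0 rs]; apply: le_trans (@running_max_ge r t _).
  by rewrite le_max lexx orbT.
by rewrite r0 (le_trans rs).
Qed.

(** Right after [t], [f] exceeds [f t], hence the running maximum at [t], by at most [e]. *)
Lemma rcll_running_max : rcll_path (running_max f).
Proof.
apply: nondecreasing_rcll_path; first exact: nondecreasing_running_max.
move=> t e t0 e0; have [h h0 H] := rcll_path_right rf t0 e0.
exists h => // s /andP[ts sth]; have s0 := le_trans t0 ts.
have M0 := running_max_ge0 t0; apply: running_max_le => //.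
  by rewrite addr_ge0// ltW.
move=> r /andP[r0 rs]; case: (leP r t) => rt.
  have := @running_max_ge r t; rewrite r0 rt ge_max => /(_ erefl)/andP[_ fM].
  by rewrite (le_trans fM)// lerDl ltW.
have := H r; rewrite (ltW rt) (le_lt_trans rs)// => /(_ erefl).
rewrite ler_distl => /andP[_ fr]; apply: (le_trans fr).
by rewrite lerD2r le_running_max.
Qed.

End running_max.

Lemma running_max_eq f g t : (forall s, 0 <= s <= t -> f s = g s) ->
  running_max f t = running_max g t.
Proof.
move=> fg; congr (sup _); apply: eq_imagel => s /=.
by rewrite in_itv/= => /fg ->.
Qed.

Lemma ler_running_max f g t : rcll_path f -> rcll_path g -> 0 <= t ->
  (forall s, 0 <= s <= t -> f s <= g s) ->
  running_max f t <= running_max g t.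
Proof.
move=> rf rg t0 fg; apply: running_max_le => //; first exact: running_max_ge0.
move=> s st; apply: le_trans (fg _ st) _.
by apply: le_trans (@running_max_ge _ rg s t st); rewrite le_max lexx orbT.
Qed.

(* For a nondecreasing [k]: the measure dk is null on some [t, t + h). *)
Definition flat_at k t : Prop :=
  (exists2 h, 0 < h & forall s, t <= s < t + h -> k s = k t) /\
  (0 < t -> forall e, 0 < e -> exists2 r, 0 <= r < t & k t <= k r + e).

Lemma flat_at_eq k k' t : (forall s, 0 <= s -> k s = k' s) -> 0 <= t ->
  flat_at k t -> flat_at k' t.
Proof.
move=> kk t0 [[h h0 kh] kl]; split.
  exists h => // s sh; rewrite -!kk//; first exact: kh.
  by move: sh => /andP[/(le_trans t0)].
move=> t0' e e0; have [r rt kr] := kl t0' e e0.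
by exists r => //; rewrite -!kk//; case/andP: rt.
Qed.

(** The gap between [f t] and the maximum persists to the right by right continuity. On the left,
    values near the maximum are taken strictly before [t], unless the maximum itself is near 0. *)
Lemma running_max_flat f t : rcll_path f -> 0 <= t -> f t < running_max f t ->
  flat_at (running_max f) t.
Proof.
move=> rf t0 ft; have d0 : 0 < running_max f t - f t by rewrite subr_gt0.
split.
  have [h h0 H] := rcll_path_right rf t0 d0.
  exists h => // s /andP[ts sth]; have s0 := le_trans t0 ts.
  apply/eqP; rewrite eq_le (nondecreasing_running_max rf t0 ts) andbT.
  apply: running_max_le => //; first exact: running_max_ge0.
  move=> r /andP[r0 rs]; case: (leP r t) => rt.
    have := @running_max_ge _ rf r t; rewrite r0 rt ge_max.
    by move=> /(_ erefl)/andP[_].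
  have := H r; rewrite (ltW rt) (le_lt_trans rs)// => /(_ erefl).
  by rewrite ler_distl => /andP[_]; rewrite subrKC.
move=> t0' e e0.
have [s /andP[s0 st]] : exists2 s, 0 <= s <= t &
    running_max f t - Num.min e (running_max f t - f t) < Num.max 0 (f s).
  by apply: running_max_adherent => //; rewrite ltrBlDr ltrDl lt_min e0.
move: st; rewrite le_eqVlt => /predU1P[->|st] H; last first.
  exists s; rewrite ?s0//; rewrite -lerBlDr.
  have := @running_max_ge _ rf s s; rewrite s0 lexx => /(_ erefl).
  apply: le_trans; apply: le_trans (ltW H).
  by rewrite lerD2l lerN2 ge_min lexx.
(* The near-maximal point is [t]. As [f t] is too small, the near-maximal value is the 0 under the
   supremum, so the maximum is at most [e]. *)
exists 0; first by rewrite lexx.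
apply: (@le_trans _ _ e); last by rewrite lerDr running_max_ge0.
move: H; rewrite lt_max => /orP[|]; last first.
  rewrite ltrBlDr -ltrBlDl lt_min ltxx andbF//.
by rewrite subr_lt0 lt_min => /andP[/ltW].
Qed.

End real_paths.

(** * Picard iteration *)

Section picard_iteration.
Context {R : realType}.
Implicit Types (a b : R -> R) (s t : R).

(* With a = l - y and b = y - u, [pushing a b m] and [pushing b a m] are the
   m-th Picard iterates of the lower and the upper pushing processes. *)
Fixpoint pushing a b (m : nat) : R -> R :=
  if m is m'.+1 then running_max (fun s => a s + pushing b a m' s) else fun=> 0.

Definition pushing_lim a b t : R := limn (fun m => pushing a b m t).

Lemma rcll_pushing a b m : rcll_path a -> rcll_path b ->
  rcll_path (pushing a b m).
Proof.
elim: m a b => [|m IH] a b ra rb /=; first exact: rcll_path_cst.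
by apply: rcll_running_max; apply: rcll_pathD => //; exact: IH.
Qed.

Lemma rcll_pushingD a b m : rcll_path a -> rcll_path b ->
  rcll_path (fun s => a s + pushing b a m s).
Proof. by move=> ra rb; apply: rcll_pathD => //; exact: rcll_pushing. Qed.

Lemma pushing_ge0 a b m t : rcll_path a -> rcll_path b -> 0 <= t ->
  0 <= pushing a b m t.
Proof.
case: m => //= m ra rb t0.
exact: (running_max_ge0 (rcll_pushingD m ra rb) t0).
Qed.

Lemma nondecreasing_pushing a b m : rcll_path a -> rcll_path b ->
  nondecreasing_path (pushing a b m).
Proof.
case: m => [|m] ra rb //=.
exact: (nondecreasing_running_max (rcll_pushingD m ra rb)).
Qed.

(** The iteration starts at 0, below its first iterate, and the running maximum is monotone. *)
Lemma pushing_leS a b m t : rcll_path a -> rcll_path b -> 0 <= t ->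
  pushing a b m t <= pushing a b m.+1 t.
Proof.
elim: m a b t => [|m IH] a b t ra rb t0; first exact: pushing_ge0.
rewrite [pushing a b m.+1]/= [pushing a b m.+2]/=.
apply: (ler_running_max (rcll_pushingD m ra rb)
  (rcll_pushingD m.+1 ra rb)) => //.
by move=> s /andP[s0 _]; rewrite lerD2l; exact: IH.
Qed.

Lemma le_pushingS a b m t : rcll_path a -> rcll_path b -> 0 <= t ->
  a t + pushing b a m t <= pushing a b m.+1 t.
Proof. by move=> ra rb t0; exact: (le_running_max (rcll_pushingD m ra rb)). Qed.

(** Time [t] is left out to match the half-open intervals of [rcll_path_induction]. *)
Definition stationary a b t n := forall m s, (n <= m)%N -> 0 <= s < t ->
  pushing a b m s = pushing a b n s.

Lemma stationaryS a b t n : stationary b a t n -> stationary a b t n.+1.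
Proof.
move=> st [//|m] s; rewrite ltnS => nm /andP[s0 sltt] /=.
apply: running_max_eq => r /andP[r0 rs]; rewrite st ?r0//.
exact: le_lt_trans sltt.
Qed.

Lemma stationaryW a b t n m : (n <= m)%N -> stationary a b t n ->
  stationary a b t m.
Proof. by move=> nm st p s mp st'; rewrite !st// (leq_trans nm). Qed.

(* With b = y - u, the hypothesis [b t + A <= B - e] reads
   y t + A - B <= u t - e: at time t the process is too far below the upper
   barrier for [pushing b a] to move on [t, t'). *)
Lemma stationary_step a b e t t' n (A B : R) : rcll_path a -> rcll_path b ->
  0 < e -> 0 <= t -> (forall s, 0 <= s -> a s + b s < - (e + e)) ->
  (forall s, t <= s < t' -> `|a s - a t| <= e /\ `|b s - b t| <= e) ->
  stationary b a t n ->
  0 <= A -> 0 <= B ->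
  (forall m s, 0 <= s < t -> pushing a b m s <= A) ->
  (forall m s, 0 <= s < t -> pushing b a m s <= B) ->
  (forall s, t <= s -> B <= pushing b a n s) ->
  b t + A <= B - e ->
  stationary b a t' n.
Proof.
move=> ra rb e0 t0 abe osc stn A0 B0 leA leB geB bAB.
have osc' s : t <= s < t' -> a s <= a t + e /\ b s <= b t + e.
  by move=> /osc[]; rewrite !ler_distl => /andP[_ ?] /andP[_ ?].
have sep := abe _ t0.
(* The two bounds support each other. On [t, t'), the second one gives b + pushing a b m <= B: for
   the term [A] by [bAB], for the term a t + e + B because a t + b t < - 2 e. The first one bounds
   the next iterate of [pushing a b]. *)
have H m s : t <= s < t' ->
    pushing b a m s <= B /\ pushing a b m s <= Num.max A (a t + e + B).
  elim: m s => [|m IH] s tst'; first by rewrite /= le_max A0.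
  have /andP[ts st'] := tst'; have s0 := le_trans t0 ts.
  split.
    apply: (running_max_le (rcll_pushingD m _ _)) => //.
    move=> r /andP[r0 rs]; case: (ltP r t) => rt.
      apply: le_trans (leB m.+1 r _); last by rewrite r0.
      exact: le_pushingS.
    have rt' : t <= r < t' by rewrite rt (le_lt_trans rs).
    have [_ Hr] := IH _ rt'; have [_ br] := osc' _ rt'.
    apply: le_trans (lerD br Hr) _.
    by rewrite -lerBrDl ge_max; apply/andP; split; lra.
  apply: (running_max_le (rcll_pushingD m _ _)) => //.
    by rewrite le_max A0.
  move=> r /andP[r0 rs]; case: (ltP r t) => rt.
    rewrite le_max; apply/orP; left.
    apply: le_trans (leA m.+1 r _); last by rewrite r0.
    exact: le_pushingS.
  have rt' : t <= r < t' by rewrite rt (le_lt_trans rs).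
  have [Hr _] := IH _ rt'; have [ar _] := osc' _ rt'.
  by rewrite le_max (lerD ar Hr) orbT.
have monn m s : (n <= m)%N -> 0 <= s -> pushing b a n s <= pushing b a m s.
  move=> /subnK <- s0; elim: (m - n)%N => // k IH.
  by rewrite (le_trans IH)// addSn pushing_leS.
move=> m s nm /andP[s0 st']; case: (ltP s t) => st.
  by apply: stn; rewrite ?s0.
(* Iterate [n] is squeezed to the value [B]; the later ones are larger but still bounded by [B]. *)
have Bn : pushing b a n s = B.
  by apply/le_anti; rewrite geB// andbT; have [] := H n s _; rewrite ?st.
apply/le_anti; rewrite monn// andbT Bn.
by have [] := H m s _; rewrite ?st.
Qed.

(** Provides the constants of [stationary_step]: for t > 0, [A] is the left limit at [t] of the
    stationary iterate. The 0 added to [S] gives the value at t = 0, where there is no earlier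
    time. *)
Lemma stationary_left_sup a b t n : rcll_path a -> rcll_path b -> 0 <= t ->
  stationary a b t n ->
  exists2 A, 0 <= A & (forall m s, 0 <= s < t -> pushing a b m s <= A) /\
    (forall s, t <= s -> A <= pushing a b n s).
Proof.
move=> ra rb t0 st.
pose S :=
  [set Num.max 0 (pushing a b n s) | s in [set s | 0 <= s < t]] `|` [set 0].
have ub s : t <= s -> ubound S (pushing a b n s).
  move=> ts _ [[r /= /andP[r0 rt] <-]|->]; last first.
    by apply: pushing_ge0 => //; exact: le_trans ts.
  rewrite ge_max pushing_ge0//=; last exact: le_trans ts.
  by apply: nondecreasing_pushing => //; exact: le_trans (ltW rt) ts.
have S0 : S 0 by right.
have hS : has_ubound S by exists (pushing a b n t); exact: ub.
exists (sup S); first exact: ub_le_sup.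
split=> [m s s0t|s ts]; last by apply: ge_sup; [exists 0|exact: ub].
apply: (@le_trans _ _ (pushing a b n s)); last first.
  apply: (@le_trans _ _ (Num.max 0 (pushing a b n s))).
    by rewrite le_max lexx orbT.
  by apply: ub_le_sup => //; left; exists s.
have /andP[s0 _] := s0t.
case: (leqP n m) => nm; first by rewrite st.
have := ltnW nm; move=> /subnK <-; elim: (n - m)%N => // k IH.
by rewrite (le_trans IH)// addSn pushing_leS.
Qed.

Lemma pushing_stationary a b (eps : R) :
  rcll_path a -> rcll_path b -> 0 < eps ->
  (forall t, 0 <= t -> a t + b t < - eps) ->
  forall t, 0 <= t -> exists n, stationary a b t n /\ stationary b a t n.
Proof.
move=> ra rb eps0 ab.
have e0 : 0 < eps / 2 by rewrite divr_gt0.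
apply: (rcll_path_induction e0 ra rb).
- move=> s t s0 st [n [H1 H2]]; exists n; split=> m r nm /andP[r0 rs];
    [apply: H1|apply: H2] => //; by rewrite r0 (lt_le_trans rs).
- by exists 0%N; split=> m r nm; case: ltgtP.
move=> t t' t0 tt' [n [st1 st2]] osc.
have [A A0 [leA geA]] := stationary_left_sup ra rb t0 st1.
have [B B0 [leB geB]] := stationary_left_sup rb ra t0 st2.
have sep := ab _ t0.
(* If [bAB] fails, then a t + B < A - eps / 2, since a t + b t < - eps, and the barriers exchange
   roles. Either way one process is stationary from [n] on, and the other follows one step later. *)
exists n.+1; case: (leP (b t + A) (B - eps / 2)) => bAB.
  have st2' : stationary b a t' n.
    apply: (@stationary_step a b (eps / 2) t t' n A B) => //.
    by move=> s s0; rewrite -splitr; exact: ab.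
  by split; [exact: stationaryS|exact: stationaryW st2'].
have st1' : stationary a b t' n.
  apply: (@stationary_step b a (eps / 2) t t' n B A) => //; last lra.
    by move=> s s0; rewrite addrC -splitr; exact: ab.
  by move=> s /osc[].
by split; [exact: stationaryW st1'|exact: stationaryS].
Qed.

Section limit.
Variables (a b : R -> R) (eps : R).
Hypotheses (ra : rcll_path a) (rb : rcll_path b) (eps0 : 0 < eps).
Hypothesis ab : forall t, 0 <= t -> a t + b t < - eps.

(** One [n] serves all of [0, t), so on bounded intervals the limits are single iterates and inherit
    their path properties. *)
Lemma pushing_lim_stationary t : 0 <= t ->
  exists n, forall s, 0 <= s < t -> forall m, (n <= m)%N ->
    pushing_lim a b s = pushing a b m s /\ pushing_lim b a s = pushing b a m s.
Proof.
move=> t0; have [n [st1 st2]] := pushing_stationary ra rb eps0 ab t0.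
exists n => s st m nm; rewrite st1// st2//.
split; apply: norm_cvg_lim; apply: cvg_near_cst; near=> k;
  [apply: st1|apply: st2] => //; near: k; exact: nbhs_infty_ge.
Unshelve. all: by end_near. Qed.

Lemma cvg_pushing t : 0 <= t ->
  pushing a b m t @[m --> \oo] --> pushing_lim a b t.
Proof.
(* Going up to t + 1 brings [t] itself into the half-open interval. *)
move=> t0; have [|n H] := @pushing_lim_stationary (t + 1).
  by rewrite addr_ge0.
apply: cvg_near_cst; exists n => // k /= nk.
by have [||-> _] := H t _ k; rewrite ?t0 ?ltrDl ?ltr01.
Qed.

Lemma nondecreasing_pushing_lim : nondecreasing_path (pushing_lim a b).
Proof.
move=> s t s0 st; have t0 := le_trans s0 st.
have [|n H] := @pushing_lim_stationary (t + 1); first by rewrite addr_ge0.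
have [||-> _] := H s _ n; rewrite ?s0 ?(le_lt_trans st) ?ltrDl ?ltr01//.
have [||-> _] := H t _ n; rewrite ?t0 ?ltrDl ?ltr01//.
exact: nondecreasing_pushing.
Qed.

Lemma rcll_pushing_lim : rcll_path (pushing_lim a b).
Proof.
apply: nondecreasing_rcll_path; first exact: nondecreasing_pushing_lim.
move=> t e t0 e0.
have [|n H] := @pushing_lim_stationary (t + 1); first by rewrite addr_ge0.
have [h h0 Hh] := rcll_path_right (rcll_pushing n ra rb) t0 e0.
exists (Num.min 1 h) => [|s /andP[ts stm]]; first by rewrite lt_min ltr01.
move: stm; rewrite -ltrBlDl lt_min !ltrBlDl => /andP[s1 sh].
have [||-> _] := H s _ n; rewrite ?(le_trans t0)//.
have [||-> _] := H t _ n; rewrite ?t0 ?ltrDl ?ltr01//.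
by have := Hh s; rewrite ts sh ler_distl => /(_ erefl)/andP[].
Qed.

Lemma pushing_lim_fixpoint t : 0 <= t ->
  pushing_lim a b t = running_max (fun s => a s + pushing_lim b a s) t.
Proof.
move=> t0; have [|n H] := @pushing_lim_stationary (t + 1).
  by rewrite addr_ge0.
have [||-> _] := H t _ n.+1; rewrite ?t0 ?ltrDl ?ltr01//=.
apply: running_max_eq => s /andP[s0 st].
by have [||_ ->] := H s _ n; rewrite ?s0 ?(le_lt_trans st) ?ltrDl ?ltr01//.
Qed.

(** A start between the barriers means a 0 <= 0 and b 0 <= 0, so no iterate moves at time 0. *)
Lemma pushing_lim0 : a 0 <= 0 -> b 0 <= 0 -> pushing_lim a b 0 = 0.
Proof.
move=> a0 b0; have cv0 : pushing a b m 0 @[m --> \oo] --> (0 : R).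
  apply: cvg_near_cst; apply: nearW => m.
  suff : pushing a b m 0 = 0 /\ pushing b a m 0 = 0 by case.
  elim: m => //= m [IH1 IH2].
  have H f : f 0 <= 0 -> running_max f 0 = 0.
    move=> f0; rewrite /running_max set_itv1 image_set1 sup1.
    by apply/max_idPl.
  by rewrite !H// ?IH1 ?IH2 addr0.
exact: (cvg_unique _ (cvg_pushing (lexx 0)) cv0).
Qed.

End limit.
End picard_iteration.

(** * The Skorokhod problem for a path *)

Section skorokhod_path.
Context {R : realType}.
Implicit Types (y l u x k kp km : R -> R) (s t e : R).

(* The integral conditions of the Skorokhod problem are expressed by [flat_at];
   [stieltjes_integral0_flat] and [flat_stieltjes_integral0] below show that
   this is the same. *)
Record skorokhod_path y l u x kp km : Prop := {
  sk_rcllp : rcll_path kp ;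
  sk_rcllm : rcll_path km ;
  sk_ndp : nondecreasing_path kp ;
  sk_ndm : nondecreasing_path km ;
  sk_p0 : kp 0 = 0 ;
  sk_m0 : km 0 = 0 ;
  sk_eq : forall t, 0 <= t -> x t = y t + kp t - km t ;
  sk_le : forall t, 0 <= t -> l t <= x t <= u t ;
  sk_flatp : forall t, 0 <= t -> l t < x t -> flat_at kp t ;
  sk_flatm : forall t, 0 <= t -> x t < u t -> flat_at km t }.

Lemma flat_at_left k k' t e : nondecreasing_path k -> nondecreasing_path k' ->
  flat_at k t -> flat_at k' t -> 0 < t -> 0 < e ->
  exists2 r, 0 <= r < t & k t <= k r + e /\ k' t <= k' r + e.
Proof.
move=> nk nk' [_ kl] [_ kl'] t0 e0.
have [r /andP[r0 rt] H] := kl t0 e e0.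
have [r' /andP[r'0 r't] H'] := kl' t0 e e0.
exists (Num.max r r'); first by rewrite le_max r0 gt_max rt.
split; [apply: le_trans H _|apply: le_trans H' _]; rewrite lerD2r;
  [apply: nk|apply: nk']; by rewrite // le_max lexx ?orbT.
Qed.

Lemma flat_at_right k k' t : flat_at k t -> flat_at k' t ->
  exists2 h, 0 < h & forall s, t <= s < t + h -> k s = k t /\ k' s = k' t.
Proof.
move=> [[h h0 H] _] [[h' h'0 H'] _].
exists (Num.min h h') => [|s /andP[ts stm]]; first by rewrite lt_min h0.
move: stm; rewrite -ltrBlDl lt_min !ltrBlDl => /andP[sh sh'].
by rewrite H ?ts// H' ?ts.
Qed.

(* While [x > x'], neither [kp] nor [km'] moves, so that [x - x'] decreases. *)
Lemma skorokhod_path_le y l u x kp km x' kp' km' :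
  skorokhod_path y l u x kp km -> skorokhod_path y l u x' kp' km' ->
  forall t, 0 <= t -> x t <= x' t.
Proof.
move=> S S' t t0; pose D s := kp s - km s - (kp' s - km' s).
have xD s : 0 <= s -> x s - x' s = D s.
  by move=> s0; rewrite (sk_eq S)// (sk_eq S')// /D; lra.
have rD : rcll_path D.
  by do 2 apply: rcll_pathB; [exact: sk_rcllp S|exact: sk_rcllm S|
    exact: sk_rcllp S'|exact: sk_rcllm S'].
(* The level e > 0 replaces 0 because flatness is available only where [D] is positive. *)
apply/ler_addgt0Pl => e e0; rewrite -lerBlDr xD//.
move: t t0; apply: real_induction_pt => t t0 H.
have flatD : 0 < D t -> flat_at kp t /\ flat_at km' t.
  move=> Dt; have := xD t t0.
  have /andP[lx xu] := sk_le S t0; have /andP[lx' xu'] := sk_le S' t0.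
  move=> xx.
  by split; [apply: sk_flatp S _ _ _|apply: sk_flatm S' _ _ _] => //; lra.
have De : D t <= e.
  have [->|tn0] := eqVneq t 0.
    by rewrite /D (sk_p0 S) (sk_m0 S) (sk_p0 S') (sk_m0 S') !subr0 ltW.
  have t0' : 0 < t by rewrite lt_def tn0.
  rewrite leNgt; apply/negP => eD.
  have [Fp Fm] := flatD (lt_trans e0 eD).
  (* From [r] to [t] only [kp] and [km'] can raise [D], each by at most a third of D t - e; this
     contradicts D r <= e < D t. *)
  have d0 : 0 < (D t - e) / 3 by rewrite divr_gt0// subr_gt0.
  have [r /andP[r0 rt] [Hp Hm]] :=
    flat_at_left (sk_ndp S) (sk_ndm S') Fp Fm t0' d0.
  have := H r; rewrite r0 rt => /(_ erefl).
  have := sk_ndm S r0 (ltW rt); have := sk_ndp S' r0 (ltW rt).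
  move: Hp Hm eD; rewrite /D; lra.
(* Below the level [e] right continuity suffices; at the level, [D] is positive and cannot
   increase. *)
case: (ltP (D t) e) => [Dlt|eD].
  have d0 : 0 < e - D t by rewrite subr_gt0.
  have [h h0 Hh] := rcll_path_right rD t0 d0.
  by exists h => // s /Hh; rewrite ler_distl => /andP[_]; lra.
have [Fp Fm] := flatD (lt_le_trans e0 eD).
have [h h0 Hh] := flat_at_right Fp Fm.
exists h => // s tsh; have [kps kms] := Hh _ tsh.
have /andP[ts _] := tsh.
have := sk_ndm S t0 ts; have := sk_ndp S' t0 ts.
by move: De; rewrite /D kps kms; lra.
Qed.

(** Flatness on the left excludes a jump of either path at [t], so the agreement before [t] reaches
    [t]. *)
Lemma flat_at_eq_right k k' t : nondecreasing_path k -> nondecreasing_path k' ->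
  k 0 = k' 0 -> 0 <= t -> (forall s, 0 <= s < t -> k s = k' s) ->
  flat_at k t -> flat_at k' t ->
  exists2 h, 0 < h & forall s, t <= s < t + h -> k s = k' s.
Proof.
move=> nk nk' kk0 t0 kk F F'.
have kkt : k t = k' t.
  have [->//|tn0] := eqVneq t 0.
  have t0' : 0 < t by rewrite lt_def tn0.
  apply/eqP; rewrite -subr_eq0 -normr_le0; apply/ler_addgt0Pl => e e0.
  have [r /andP[r0 rt] [H H']] := flat_at_left nk nk' F F' t0' e0.
  have := nk _ _ r0 (ltW rt); have := nk' _ _ r0 (ltW rt).
  by move: H H'; rewrite (kk r) ?r0// ler_norml; lra.
have [h h0 Hh] := flat_at_right F F'.
by exists h => // s /Hh[-> ->].
Qed.

Lemma skorokhod_path_unique y l u x kp km x' kp' km' :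
  (forall t, 0 <= t -> l t < u t) ->
  skorokhod_path y l u x kp km -> skorokhod_path y l u x' kp' km' ->
  forall t, 0 <= t -> [/\ x t = x' t, kp t = kp' t & km t = km' t].
Proof.
move=> lu S S'.
have xx t : 0 <= t -> x t = x' t.
  move=> t0; apply/le_anti.
  by rewrite (skorokhod_path_le S S')// (skorokhod_path_le S' S).
suff kk t : 0 <= t -> kp t = kp' t.
  move=> t t0; split; [exact: xx|exact: kk|].
  by have := xx t t0; rewrite (sk_eq S)// (sk_eq S')// kk//; lra.
move: t; apply: real_induction_pt => t t0 H.
(* As x = x', equality may be proved for whichever pair is flat at [t]. *)
have kkm s : 0 <= s -> kp s = kp' s <-> km s = km' s.
  by move=> s0; have := xx s s0; rewrite (sk_eq S)// (sk_eq S')//; split; lra.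
case: (ltP (l t) (x t)) => lx.
  apply: flat_at_eq_right => //; first exact: sk_ndp S.
  - exact: sk_ndp S'.
  - by rewrite (sk_p0 S) (sk_p0 S').
  - exact: sk_flatp S _ _ _.
  - by apply: sk_flatp S' _ _ _ => //; rewrite -xx.
have xu : x t < u t by rewrite (le_lt_trans lx)// lu.
have [|||||||h h0 Hh] := @flat_at_eq_right km km' t => //.
- exact: sk_ndm S.
- exact: sk_ndm S'.
- by rewrite (sk_m0 S) (sk_m0 S').
- by move=> s /[dup] /andP[s0 _] /H; exact: (kkm s s0).1.
- exact: sk_flatm S _ _ _.
- by apply: sk_flatm S' _ _ _ => //; rewrite -xx.
exists h => // s /[dup] /andP[ts _] /Hh; exact: (kkm s (le_trans t0 ts)).2.
Qed.

(** The random variables built in the end agree with the Picard limits at nonnegative times only. *)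
Lemma skorokhod_path_eq y l u x kp km x' kp' km' :
  (forall t, 0 <= t -> [/\ x t = x' t, kp t = kp' t & km t = km' t]) ->
  skorokhod_path y l u x kp km -> skorokhod_path y l u x' kp' km'.
Proof.
move=> E S.
have xE t : 0 <= t -> x t = x' t by move=> /E[].
have pE t : 0 <= t -> kp t = kp' t by move=> /E[].
have mE t : 0 <= t -> km t = km' t by move=> /E[].
split.
- exact: rcll_path_eq pE (sk_rcllp S).
- exact: rcll_path_eq mE (sk_rcllm S).
- move=> s t s0 st; have t0 := le_trans s0 st.
  by rewrite -!pE//; exact: (sk_ndp S).
- move=> s t s0 st; have t0 := le_trans s0 st.
  by rewrite -!mE//; exact: (sk_ndm S).
- by rewrite -pE// (sk_p0 S).
- by rewrite -mE// (sk_m0 S).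
- by move=> t t0; rewrite -xE// -pE// -mE// (sk_eq S).
- by move=> t t0; rewrite -xE// (sk_le S).
- move=> t t0; rewrite -xE// => lx.
  exact: flat_at_eq pE t0 (sk_flatp S t0 lx).
- move=> t t0; rewrite -xE// => xu.
  exact: flat_at_eq mE t0 (sk_flatm S t0 xu).
Qed.

(** The fixed-point equations give K+ >= L - Y + K- and K- >= Y - U + K+, that is L <= X <= U. Where
    X > L the first inequality is strict and [running_max_flat] applies to K+; likewise for K- where
    X < U. *)
Lemma pushing_lim_skorokhod y l u (eps : R) :
  rcll_path y -> rcll_path l -> rcll_path u -> l 0 <= y 0 <= u 0 ->
  0 < eps -> (forall t, 0 <= t -> eps < u t - l t) ->
  let a := fun t => l t - y t in let b := fun t => y t - u t in
  skorokhod_path y l u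
    (fun t => y t + pushing_lim a b t - pushing_lim b a t)
    (pushing_lim a b) (pushing_lim b a).
Proof.
move=> ry rl ru /andP[ly yu] eps0 ulE a b.
have ra : rcll_path a by exact: rcll_pathB.
have rb : rcll_path b by exact: rcll_pathB.
have ab t : 0 <= t -> a t + b t < - eps by move=> /ulE; rewrite /a /b; lra.
have ba t : 0 <= t -> b t + a t < - eps by rewrite addrC; exact: ab.
have a0 : a 0 <= 0 by rewrite subr_le0.
have b0 : b 0 <= 0 by rewrite subr_le0.
have rA := rcll_pushing_lim ra rb eps0 ab.
have rB := rcll_pushing_lim rb ra eps0 ba.
have fA := pushing_lim_fixpoint ra rb eps0 ab.
have fB := pushing_lim_fixpoint rb ra eps0 ba.
have raB := rcll_pathD ra rB; have rbA := rcll_pathD rb rA.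
split=> //.
- exact: nondecreasing_pushing_lim eps0 ab.
- exact: nondecreasing_pushing_lim eps0 ba.
- exact: pushing_lim0 eps0 ab _ _.
- exact: pushing_lim0 eps0 ba _ _.
- move=> t t0; have := le_running_max raB t0; have := le_running_max rbA t0.
  by rewrite -fA// -fB// /a /b; lra.
- move=> t t0 lx; have [||F1 F2] := @running_max_flat _ _ t raB => //.
    by rewrite -fA//; move: lx; rewrite /a; lra.
  apply: flat_at_eq (conj F1 F2) => // s s0; exact/esym/fA.
- move=> t t0 lx; have [||F1 F2] := @running_max_flat _ _ t rbA => //.
    by rewrite -fB//; move: lx; rewrite /b; lra.
  apply: flat_at_eq (conj F1 F2) => // s s0; exact/esym/fB.
Qed.

End skorokhod_path.

(** * Stieltjes integrals *)

Section stieltjes.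
Context {R : realType}.
Implicit Types (f k : R -> R) (s t e h : R).

(** [f] is the pointwise limit of step functions that read it at the next grid point; the successor
    in [grid] puts this point strictly to the right of [t], within 1 / (n + 1). *)
Lemma right_continuous_measurable f :
  (forall t, 0 <= t -> f x @[x --> t^'+] --> f t) ->
  measurable_fun (`[0, +oo[%classic : set (measurableTypeR R)) f.
Proof.
move=> fr.
pose grid n t : R := (Num.truncn (t * n.+1%:R)).+1%:R / n.+1%:R.
have n0 n : 0 < n.+1%:R :> R by rewrite ltr0n.
apply: (@measurable_fun_cvg _ _ _ _ (fun n t => f (grid n t))).
  move=> n _ B mB.
  rewrite [X in measurable X](_ : _ =
      \bigcup_(m in [set m | B (f (m.+1%:R / n.+1%:R))])
      `[m%:R / n.+1%:R, m.+1%:R / n.+1%:R[%classic).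
    by apply: bigcup_measurable => m _; exact: measurable_itv.
  apply/seteqP; split => [t [/=]|t [m /= Bm]].
    rewrite in_itv/= andbT => t0 Bt.
    exists (Num.truncn (t * n.+1%:R)) => //=.
    have tn : 0 <= t * n.+1%:R by rewrite mulr_ge0.
    by rewrite in_itv/= ler_pdivrMr// ltr_pdivlMr// truncn_itv.
  rewrite !in_itv/= => /andP[mt tm].
  have t0 : 0 <= t by apply: le_trans mt; rewrite divr_ge0.
  split; first by rewrite t0.
  rewrite /grid; suff -> : Num.truncn (t * n.+1%:R) = m by [].
  apply/eqP; rewrite truncn_eq ?mulr_ge0//.
  by rewrite -ler_pdivrMr// -ltr_pdivlMr// mt.
move=> t /=; rewrite in_itv/= andbT => t0.
apply/cvgrPdist_le => e e0; have /cvgrPdist_le/(_ _ e0) fe := fr _ t0.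
have [|h h0 H] := @near_right_itv _ t (fun s => `|f t - f s| <= e) fe.
  by rewrite subrr normr0 ltW.
near=> n; apply: H.
have tn : 0 <= t * n.+1%:R by rewrite mulr_ge0.
rewrite /grid ler_pdivlMr// ltW ?truncnS_gt//=.
rewrite ltr_pdivrMr// mulrDl -natr1 ler_ltD ?truncn_le//.
rewrite -ltr_pdivrMr// div1r.
by near: n; exact: near_infty_natSinv_lt (PosNum h0).
Unshelve. all: by end_near. Qed.

Section cumulative_measure.
Variable c : cumulative R R.
Let mu := lebesgue_stieltjes_measure c.

Lemma lebesgue_stieltjes_measure_itvoc s t : s <= t ->
  mu `]s, t]%classic = (c t - c s)%:E.
Proof.
move=> st; rewrite /mu /lebesgue_stieltjes_measure /measure_extension/=.
by rewrite measurable_mu_extE/= ?wlength_itv_bnd//; exact: is_ocitv.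
Qed.

Lemma stieltjes_null_right t b : mu `[t, b]%classic = 0%E ->
  forall s, t <= s <= b -> c s = c t.
Proof.
move=> tb0 s /andP[ts sb].
have : mu `]t, s]%classic = 0%E.
  apply: (subset_measure0 _ _ _ tb0) => //.
  by move=> r /=; rewrite !in_itv/= => /andP[/ltW -> rs]; exact: le_trans rs sb.
rewrite lebesgue_stieltjes_measure_itvoc// => -[] /eqP.
by rewrite subr_eq0 => /eqP.
Qed.

(** The intervals ]t - 1 / (n + 1), t] shrink to the point [t], so their masses tend to 0. *)
Lemma stieltjes_null_left t e : mu [set t] = 0%E -> 0 < e ->
  exists2 r, r < t & c t <= c r + e.
Proof.
move=> mut e0.
have cv : mu `]t - n.+1%:R^-1, t]%classic @[n --> \oo] --> mu [set t].
  rewrite [X in _ --> mu X]set1_bigcap_oc; apply: nonincreasing_cvg_mu.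
  - rewrite [X in (mu X < _)%E]/= lebesgue_stieltjes_measure_itvoc ?ltry//.
    by rewrite lerBlDr lerDl invr_ge0.
  - by move=> i; exact: measurable_itv.
  - by apply: bigcap_measurable => // i _; exact: measurable_itv.
  - move=> m n mn; apply/subsetPset => r /=; rewrite !in_itv/=.
    move=> /andP[tr ->]; rewrite andbT; apply: le_lt_trans tr.
    by rewrite lerD2l lerN2 lef_pV2 ?posrE ?ltr0n// ler_nat.
have /fine_cvgP[_ /cvgrPdist_le/(_ _ e0)] :
  mu `]t - n.+1%:R^-1, t]%classic @[n --> \oo] --> 0%R%:E.
  by rewrite -[0%R%:E]mut.
move=> [n _ /(_ n)/=]; rewrite leqnn => /(_ isT).
have tn : t - n.+1%:R^-1 < t by rewrite ltrBlDr ltrDl invr_gt0 ltr0n.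
rewrite lebesgue_stieltjes_measure_itvoc ?(ltW tn)//= sub0r normrN ler_norml.
by move=> /andP[_ H]; exists (t - n.+1%:R^-1); rewrite // -lerBlDl.
Qed.

Lemma stieltjes_null_itv t b : t <= b -> c b = c t ->
  (forall e, 0 < e -> exists2 r, r < t & c t <= c r + e) ->
  mu `[t, b]%classic = 0%E.
Proof.
move=> tb cbt cl; apply/eqP; rewrite -measure_le0.
apply/lee_addgt0Pr => e e0; rewrite add0e; have [r rt cr] := cl e e0.
apply: (@le_trans _ _ (mu `]r, b]%classic)).
  apply: le_measure; rewrite ?inE; [exact: measurable_itv..|].
  by move=> s /=; rewrite !in_itv/= => /andP[ts ->]; rewrite (lt_le_trans rt).
rewrite lebesgue_stieltjes_measure_itvoc; last by rewrite (le_trans (ltW rt)).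
by rewrite lee_fin cbt lerBlDl.
Qed.

Lemma stieltjes_integral_eq0 f b :
  (forall t, 0 <= t -> f x @[x --> t^'+] --> f t) ->
  (forall t, 0 <= t -> 0 <= f t) ->
  (\int[mu]_(s in `[0%R, b]) (f s)%:E = 0)%E <->
  mu.-negligible [set s | 0 <= s <= b /\ 0 < f s].
Proof.
move=> fr f0.
pose D : set (measurableTypeR R) := `[0, b]%classic.
have mf : measurable_fun D (EFin \o f).
  apply/measurable_EFinP.
  apply: measurable_funS (right_continuous_measurable fr) => //.
  by move=> s; rewrite /D/= !in_itv/= => /andP[->].
have mb : measurable D by exact: measurable_itv.
have -> : (\int[mu]_(s in `[0%R, b]) (f s)%:E =
           \int[mu]_(s in D) `|(f s)%:E|)%E.
  apply: eq_integral => s; rewrite inE/= in_itv/= => /andP[s0 _].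
  by rewrite ger0_norm// f0.
rewrite (ae_eq_integral_abs mu mb mf).
rewrite /ae_eq /almost_everywhere.
have -> // : [set s | 0 <= s <= b /\ 0 < f s] =
  ~` [set s | D s -> (EFin \o f) s = cst 0%E s].
apply/seteqP; split => s /=; rewrite /D/= in_itv/=.
  by move=> [sb fs] /(_ sb)[] fs0; move: fs; rewrite fs0 ltxx.
move=> /not_implyP[/andP[s0 sb] fs]; rewrite s0 sb; split=> //.
by rewrite lt_def f0// andbT; apply/eqP => fs0; apply: fs; rewrite fs0.
Qed.

End cumulative_measure.

(** By right continuity [f] stays positive right after [t], so some [t, t + h / 2] is a null set:
    [k] is constant on it, and the null mass of [t] excludes a jump there. *)
Lemma stieltjes_integral0_flat f k :
  (forall t, 0 <= t -> f x @[x --> t^'+] --> f t) ->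
  (forall t, 0 <= t -> 0 <= f t) ->
  (forall b, 0 < b -> is_stieltjes_integral f k b 0%E) ->
  forall t, 0 <= t -> 0 < f t -> flat_at k t.
Proof.
move=> fr f0 int0 t t0 ft.
have [|h h0 H] := @near_right_itv _ t (fun s => 0 < f s) _ ft.
  exact: (cvgr_gt (f t) (fr _ t0)).
have h20 : 0 < h / 2 by rewrite divr_gt0.
have b0 : 0 < t + h / 2 by rewrite ltr_wpDl.
have [c ck /stieltjes_integral_eq0] := int0 _ b0.
move=> /(_ fr f0) neg.
have mu0 : lebesgue_stieltjes_measure c `[t, t + h / 2]%classic = 0%E.
  apply/negligibleP; first exact: measurable_itv.
  apply: negligibleS neg => s /=; rewrite in_itv/= => /andP[ts sb].
  rewrite (le_trans t0 ts) sb; split=> //; apply: H; rewrite ts/=.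
  by rewrite (le_lt_trans sb)// ltrD2l ltr_pdivrMr// ltr_pMr// ltr1n.
have ckE s : 0 <= s -> c s = k s by move=> s0; rewrite ck max_r.
split.
  exists (h / 2) => // s /andP[ts sb].
  rewrite -!ckE//; last exact: le_trans ts.
  by apply: stieltjes_null_right mu0 _ _; rewrite ts ltW.
move=> t0' e e0.
have mut : lebesgue_stieltjes_measure c [set t] = 0%E.
  apply: (subset_measure0 _ _ _ mu0) => //.
  by move=> _ /= ->; rewrite in_itv/= lexx lerDl ltW.
have [r rt cr] := stieltjes_null_left mut e0.
(* The witness may be negative; the extension of [k] takes the value [k 0] there. *)
exists (Num.max 0 r); first by rewrite le_max lexx/= gt_max t0'.
by rewrite -ckE// -ck.
Qed.

(** The set where f > e is negligible for each e > 0, by induction on time. The threshold matters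
    when f t = 0: [f] may be positive right after [t] while [k] is not flat at [t], but it stays
    below [e] for a while. *)
Lemma flat_stieltjes_integral0 f k :
  (forall t, 0 <= t -> f x @[x --> t^'+] --> f t) ->
  (forall t, 0 <= t -> 0 <= f t) ->
  rcll_path k -> nondecreasing_path k ->
  (forall t, 0 <= t -> 0 < f t -> flat_at k t) ->
  forall b, is_stieltjes_integral f k b 0%E.
Proof.
move=> fr f0 rk nk flat b.
pose k0 t := k (Num.max 0 t).
have k0_nd : nondecreasing k0.
  move=> s t st; apply: nk; first by rewrite le_max lexx.
  by rewrite ge_max !le_max lexx/= st orbT.
have k0_rc : right_continuous k0.
  move=> t; case: (leP 0 t) => t0.
    rewrite [X in _ --> X](_ : _ = k t); last by rewrite /k0 max_r.
    apply: cvg_trans (rk.1 t t0); apply: near_eq_cvg; near=> s.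
    rewrite /k0 max_r//; apply: le_trans t0 _.
    by near: s; exact: nbhs_right_ge.
  apply: cvg_near_cst; near=> s; rewrite /k0 !max_l//; first exact: ltW.
  by near: s; exact: nbhs_right_le.
pose c : cumulative R R := HB.pack k0 (isCumulative.Build R _ R k0 k0_nd k0_rc).
have ck s : 0 <= s -> c s = k s by move=> s0; rewrite /= /k0 max_r.
exists c => //; apply/stieltjes_integral_eq0 => //.
set mu := lebesgue_stieltjes_measure c.
suff neg e : 0 < e -> forall t, 0 <= t ->
    mu.-negligible [set s | 0 <= s < t /\ e < f s].
  case: (ltP b 0) => b0.
    apply: negligibleS (negligible_set0 mu) => s /= [/andP[s0 /(le_trans s0)]].
    by rewrite leNgt b0.
  apply: (@negligibleS _ _ _ mu
    (\bigcup_n [set s : measurableTypeR R |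
      0 <= (s : R) < b + 1 /\ n.+1%:R^-1 < f s])).
    move=> s /= [/andP[s0 sb] fs].
    have [n] : exists n : nat, n.+1%:R^-1 < f s.
      have [n _ /(_ n)/=] := near_infty_natSinv_lt (PosNum fs).
      by rewrite leqnn => /(_ isT); exists n.
    by move=> nfs; exists n => //=; rewrite s0 (le_lt_trans sb)// ltrDl.
  apply: negligible_bigcup => n; apply: neg; first by rewrite invr_gt0 ltr0n.
  by rewrite addr_ge0.
move=> e0; apply: real_induction.
- move=> s t s0 st; apply: negligibleS => r /= [/andP[r0 rs] fr'].
  by rewrite r0 (lt_le_trans rs).
- by apply: negligibleS (negligible_set0 mu) => r /= [+ _]; case: ltgtP.
- move=> t t0 negt; case: (ltP (f t) e) => fe.
    have [||h h0 H] := @near_right_itv _ t (fun s => f s < e) => //.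
      exact: (cvgr_lt (f t) (fr _ t0)).
    exists (t + h); first by rewrite ltrDl.
    apply: negligibleS negt => s /= [/andP[s0 sth] es].
    rewrite s0; split=> //; rewrite ltNge; apply/negP => ts.
    by have := H s; rewrite ts sth => /(_ isT); rewrite ltNge (ltW es).
  have [[h h0 H] Hl] := flat _ t0 (lt_le_trans e0 fe).
  have h20 : 0 < h / 2 by rewrite divr_gt0.
  exists (t + h / 2); first by rewrite ltrDl.
  have : mu `[t, t + h / 2]%classic = 0%E.
    apply: stieltjes_null_itv; first by rewrite lerDl ltW.
      rewrite !ck// ?addr_ge0// ?(ltW h20)//; apply: H.
      by rewrite lerDl (ltW h20) ltrD2l ltr_pdivrMr// ltr_pMr// ltr1n.
    (* At time 0 the witness -1 lies in the constant extension of [k], so that no mass sits at 0. *)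
    move=> d d0; have [tE|tn0] := eqVneq t 0.
      exists (-1); first by rewrite tE ltrN10.
      by rewrite /= /k0 tE maxxx max_l ?lerN10// lerDl ltW.
    have [|r /andP[r0 rt] Hr] := Hl _ d d0; first by rewrite lt_def tn0.
    by exists r => //; rewrite !ck.
  move=> /negligibleP; rewrite -/mu => /(_ (measurable_itv _)) negt'.
  apply: negligibleS (negligibleU negt negt') => s /= [/andP[s0 st] es].
  case: (ltP s t) => st'; [left; split => //; exact/andP|right].
  by rewrite in_itv/= st' ltW.
- move=> t t0 H.
  apply: (@negligibleS _ _ _ mu
      (\bigcup_n [set s : measurableTypeR R |
        0 <= (s : R) < Num.max 0 (t - n.+1%:R^-1) /\ e < f s])).
    move=> s /= [/andP[s0 st] es].
    have ts : 0 < t - s by rewrite subr_gt0.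
    have [n _ /(_ n)/=] := near_infty_natSinv_lt (PosNum ts).
    rewrite leqnn => /(_ isT) nts; exists n => //=; rewrite s0; split => //.
    by rewrite lt_max ltrBrDr -ltrBrDl nts orbT.
  apply: negligible_bigcup => n; apply: H; rewrite le_max lexx/= gt_max t0/=.
  by rewrite ltrBlDr ltrDl invr_gt0 ltr0n.
Unshelve. all: by end_near. Qed.

End stieltjes.

(** * Adapted processes *)

Section adapted_processes.
Context {R : realType} {d : measure_display} {T : measurableType d}.
Implicit Types (F : R -> set_system T) (X : R -> T -> R).

(** A sigma-algebra generates itself. This turns adaptedness into measurability on a structured
    type, where the closure properties of measurable functions apply. *)
Lemma g_sigma_measurable_funP (G : set_system T) (X : T -> R) :
  sigma_algebra setT G ->
  measurable_fun (setT : set (g_sigma_algebraType G)) X <->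
  (forall B, measurable B -> G (X @^-1` B)).
Proof.
move=> sG; split => [mX B mB|GX _ B mB].
  by have := mX measurableT B mB; rewrite setTI /measurable/= sigma_algebra_id.
by rewrite setTI /measurable/= sigma_algebra_id//; exact: GX.
Qed.

Lemma adaptedP F X : filtration F -> adapted F X <->
  forall t, 0 <= t ->
    measurable_fun (setT : set (g_sigma_algebraType (F t))) (X t).
Proof.
move=> [sF _ _]; split=> aX t t0.
  by apply/g_sigma_measurable_funP; [exact: sF|exact: aX].
by apply/g_sigma_measurable_funP; [exact: sF|exact: aX].
Qed.

Lemma adapted_measurable F X t : filtration F -> adapted F X -> 0 <= t ->
  measurable_fun setT (X t).
Proof. by move=> [_ Fm _] aX t0 _ B mB; rewrite setTI; apply/Fm/aX. Qed.

Lemma adapted_le F X s t : filtration F -> adapted F X -> 0 <= s -> s <= t ->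
  measurable_fun (setT : set (g_sigma_algebraType (F t))) (X s).
Proof.
move=> [sF _ Fle] aX s0 st; apply/g_sigma_measurable_funP.
  by apply: sF; exact: le_trans st.
by move=> B mB; apply: (Fle s t s0 st); exact: aX.
Qed.

Lemma adaptedD F X Y : filtration F -> adapted F X -> adapted F Y ->
  adapted F (fun t w => X t w + Y t w).
Proof.
move=> hF /(adaptedP _ hF) aX /(adaptedP _ hF) aY.
apply/(adaptedP _ hF) => t t0.
by apply: measurable_funD; [exact: aX|exact: aY].
Qed.

Lemma adaptedB F X Y : filtration F -> adapted F X -> adapted F Y ->
  adapted F (fun t w => X t w - Y t w).
Proof.
move=> hF /(adaptedP _ hF) aX /(adaptedP _ hF) aY.
apply/(adaptedP _ hF) => t t0.
by apply: measurable_funB; [exact: aX|exact: aY].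
Qed.

Lemma adapted_cst F (c : R) : filtration F -> adapted F (fun _ _ => c).
Proof. by move=> hF; apply/(adaptedP _ hF) => t t0; exact: measurable_cst. Qed.

Lemma adapted_cvg F (X : nat -> R -> T -> R) Y : filtration F ->
  (forall m, adapted F (X m)) ->
  (forall t w, 0 <= t -> X m t w @[m --> \oo] --> Y t w) ->
  adapted F Y.
Proof.
move=> hF aX XY; apply/(adaptedP _ hF) => t t0.
apply: (@measurable_fun_cvg _ (g_sigma_algebraType (F t)) R setT
  (fun m => X m t)) => [m|w _]; last exact: XY.
exact: (iffLR (adaptedP _ hF) (aX m)).
Qed.

(** Serves to set the paths outside an almost sure event to 0 without losing adaptedness. *)
Lemma adapted_indic F X (G : set T) : filtration F -> F 0 G -> adapted F X ->
  adapted F (fun t w => \1_G w * X t w).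
Proof.
move=> hF FG /(adaptedP _ hF) aX; have [sF _ Fle] := hF.
apply/(adaptedP _ hF) => t t0; apply: measurable_funM; last exact: aX.
apply: (@measurable_indic _ (g_sigma_algebraType (F t))).
rewrite /measurable/= sigma_algebra_id; last exact: sF.
exact: Fle FG.
Qed.

(* A countable dense subset of [0, 1] that contains 1. *)
Let unit_rat (n : nat) : R :=
  if unpickle n is Some r then Num.min 1 (Num.max 0 (ratr (r : rat))) else 0.

Let unit_rat_itv n : 0 <= unit_rat n <= 1.
Proof.
rewrite /unit_rat; case: unpickle => [r|]; last by rewrite lexx ler01.
by rewrite le_min ler01 le_max lexx ge_min lexx.
Qed.

Let unit_rat_dense (r : rat) : 0 <= (ratr r : R) <= 1 ->
  exists n, unit_rat n = ratr r.
Proof.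
move=> /andP[r0 r1]; exists (pickle r).
by rewrite /unit_rat pickleK max_r// min_r.
Qed.

(** By right continuity, the value at s < t is approached at rational multiples of [t] just after
    [s]. The endpoint cannot be approached from the right within [0, t], and is reached by the
    multiplier 1. *)
Lemma running_max_sups (x : R -> R) t : rcll_path x -> 0 <= t ->
  running_max x t = sups (fun n => Num.max 0 (x (t * unit_rat n))) 0%N.
Proof.
move=> rx t0; set u := fun n : nat => _.
have uM n : u n <= running_max x t.
  have /andP[q0 q1] := unit_rat_itv n.
  by apply: running_max_ge; rewrite // mulr_ge0// ler_piMr.
have ubu : has_ubound [set u k | k in [set k | 0 <= k]%N].
  by exists (running_max x t) => _ [n _ <-].
have us n : u n <= sups u 0%N by apply: ub_le_sup => //; exists n.
apply/le_anti/andP; split; last first.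
  by apply: ge_sup => [|_ [n _ <-]//]; exists (u 0%N), 0%N.
apply: running_max_le => //.
  by apply: le_trans (us 0%N); rewrite le_max lexx.
move=> s /andP[s0]; rewrite le_eqVlt => /predU1P[->|st].
  have [|n n1] := @unit_rat_dense 1; first by rewrite rmorph1 ler01 lexx.
  apply: le_trans (us n); rewrite /u n1 rmorph1 mulr1.
  by rewrite le_max lexx orbT.
have t0' : 0 < t by exact: le_lt_trans st.
apply/ler_addgt0Pl => e e0; have [h h0 H] := rcll_path_right rx s0 e0.
have stt : s / t < Num.min 1 ((s + h) / t).
  by rewrite lt_min ltr_pdivrMr// mul1r st ltr_pM2r ?invr_gt0// ltrDl.
have [r] := rat_in_itvoo stt.
rewrite in_itv/= lt_min => /and3P[]; rewrite ltr_pdivrMr// ltr_pdivlMr//.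
move=> sr r1 rh.
have [|n nr] := @unit_rat_dense r.
  by rewrite (ltW r1) andbT -(pmulr_lge0 _ t0') (le_trans s0)// ltW.
have := H (t * unit_rat n); rewrite nr mulrC (ltW sr) rh => /(_ isT).
rewrite ler_distlC => /andP[_ ]; rewrite addrC => /le_trans; apply.
rewrite lerD2l; apply: le_trans (us n); rewrite /u nr mulrC.
by rewrite le_max lexx orbT.
Qed.

Lemma adapted_running_max F X : filtration F -> adapted F X ->
  (forall w, rcll_path (X ^~ w)) ->
  adapted F (fun t w => running_max (X ^~ w) t).
Proof.
move=> hF aX rX; apply/(adaptedP _ hF) => t t0.
rewrite (_ : (fun w => _) = fun w =>
    sups (fun n => Num.max 0 (X (t * unit_rat n) w)) 0%N); last first.
  by apply/funext => w; exact: running_max_sups.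
apply: (@measurable_fun_sups _ (g_sigma_algebraType (F t)) R setT
    (fun n w => Num.max 0 (X (t * unit_rat n) w))) => [w _|n].
  exists (running_max (X ^~ w) t) => _ [n _ <-].
  have /andP[q0 q1] := unit_rat_itv n.
  by apply: running_max_ge; rewrite // mulr_ge0// ler_piMr.
apply: measurable_maxr; first exact: measurable_cst.
have /andP[q0 q1] := unit_rat_itv n.
by apply: adapted_le; rewrite // ?mulr_ge0// ler_piMr.
Qed.

Lemma adapted_pushing F A B m : filtration F -> adapted F A -> adapted F B ->
  (forall w, rcll_path (A ^~ w)) -> (forall w, rcll_path (B ^~ w)) ->
  adapted F (fun t w => pushing (A ^~ w) (B ^~ w) m t).
Proof.
move=> hF; elim: m A B => [|m IH] A B aA aB rA rB /=; first exact: adapted_cst.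
apply: (@adapted_running_max F
  (fun t w => A t w + pushing (B ^~ w) (A ^~ w) m t)) => //.
  by apply: adaptedD => //; exact: IH.
by move=> w; exact: rcll_pushingD.
Qed.

End adapted_processes.

(** * From paths to processes *)

Section skorokhod_problem.
Context {R : realType} {d : measure_display} {T : measurableType d}.
Context {P : probability T R}.
Implicit Types (F : R -> set_system T).

Lemma process_of_measurable (K : R -> T -> R) :
  (forall t, measurable_fun setT (K t)) ->
  exists K' : R -> {RV P >-> R}, forall t w, K' t w = K t w.
Proof.
move=> mK.
pose K' t : {RV P >-> R} :=
  HB.pack (K t) (isMeasurableFun.Build _ _ _ _ (K t) (mK t)).
by exists K'.
Qed.

Lemma skorokhod_solution_path F (Y L U X Kp Km : R -> {RV P >-> R}) :
  rcll Y -> rcll L -> rcll U -> skorokhod_solution F Y L U X Kp Km ->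
  {ae P, forall w, skorokhod_path (Y ^~ w) (L ^~ w) (U ^~ w)
    (X ^~ w) (Kp ^~ w) (Km ^~ w)}.
Proof.
move=> rY rL rU [[[rp _ p0 _ ndp] [rm _ m0 _ ndm]] XE LXU int].
near=> w.
have XEw : forall t, 0 <= t -> X t w = Y t w + Kp t w - Km t w by near: w.
have LXUw : forall t, 0 <= t -> L t w <= X t w <= U t w by near: w.
have intw : forall b, 0 < b ->
    is_stieltjes_integral (fun s => X s w - L s w) (Kp ^~ w) b 0%E /\
    is_stieltjes_integral (fun s => U s w - X s w) (Km ^~ w) b 0%E by near: w.
(* The path regularity of [X] comes from its decomposition. *)
have rX : rcll_path (X ^~ w).
  apply: (@rcll_path_eq _ (fun t => Y t w + Kp t w - Km t w)).
    by move=> t t0; rewrite XEw.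
  by apply: rcll_pathB; [apply: rcll_pathD|].
split => //; try by near: w.
- move=> t t0 lx.
  apply: (@stieltjes_integral0_flat _ (fun s => X s w - L s w)) => //.
  + exact: (rcll_pathB rX (rL w)).1.
  + by move=> s s0; rewrite subr_ge0; case/andP: (LXUw s s0).
  + by move=> b /intw[].
  + by rewrite subr_gt0.
- move=> t t0 xu.
  apply: (@stieltjes_integral0_flat _ (fun s => U s w - X s w)) => //.
  + exact: (rcll_pathB (rU w) rX).1.
  + by move=> s s0; rewrite subr_ge0; case/andP: (LXUw s s0).
  + by move=> b /intw[].
  + by rewrite subr_gt0.
Unshelve. all: by end_near. Qed.

Lemma skorokhod_path_solution F (Y L U X Kp Km : R -> {RV P >-> R}) :
  rcll Y -> rcll L -> rcll U ->
  rcll Kp -> rcll Km -> adapted F Kp -> adapted F Km ->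
  {ae P, forall w, skorokhod_path (Y ^~ w) (L ^~ w) (U ^~ w)
    (X ^~ w) (Kp ^~ w) (Km ^~ w)} ->
  skorokhod_solution F Y L U X Kp Km.
Proof.
move=> rY rL rU rp rm ap am S.
have incr (K : R -> {RV P >-> R}) : rcll K -> adapted F K ->
    {ae P, forall w, K 0 w = 0 /\ nondecreasing_path (K ^~ w)} ->
    increasing_process F K.
  move=> rK aK KE; split => //; apply: filterS KE => w [K0 ndK] //.
  by move=> t t0; rewrite -K0; exact: ndK.
split.
- split; apply: incr => //; apply: filterS S => w S.
    by split; [exact: sk_p0 S|exact: sk_ndp S].
  by split; [exact: sk_m0 S|exact: sk_ndm S].
- by apply: filterS S => w S; exact: sk_eq S.
- by apply: filterS S => w S; exact: sk_le S.
- apply: filterS S => w S b b0.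
  have rX : rcll_path (X ^~ w).
    apply: (@rcll_path_eq _ (fun t => Y t w + Kp t w - Km t w)).
      by move=> t t0; rewrite (sk_eq S).
    by apply: rcll_pathB; [apply: rcll_pathD|].
  split; apply: flat_stieltjes_integral0 => //.
  + exact: (rcll_pathB rX (rL w)).1.
  + by move=> s s0; rewrite subr_ge0; case/andP: (sk_le S s0).
  + exact: sk_ndp S.
  + by move=> t t0; rewrite subr_gt0; exact: sk_flatp S _ _.
  + exact: (rcll_pathB (rU w) rX).1.
  + by move=> s s0; rewrite subr_ge0; case/andP: (sk_le S s0).
  + exact: sk_ndm S.
  + by move=> t t0; rewrite subr_gt0; exact: sk_flatm S _ _.
Qed.

End skorokhod_problem.

Theorem proposition3 (R : realType) (d : measure_display)
    (T : measurableType d) (P : probability T R) (F : R -> set_system T)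
    (hF : filtration F) (hFP : usual_conditions P F)
    (Y L U : R -> {RV P >-> R})
    (hY : rcll Y) (hL : rcll L) (hU : rcll U)
    (aY : adapted F Y) (aL : adapted F L) (aU : adapted F U)
    (h0 : {ae P, forall w, L 0 w <= Y 0 w <= U 0 w})
    (hsep : exists2 eps : R, 0 < eps &
      {ae P, forall w, forall t, 0 <= t -> eps < U t w - L t w}) :
  (exists X Kp Km : R -> {RV P >-> R}, skorokhod_solution F Y L U X Kp Km) /\
  (forall X Kp Km X' Kp' Km' : R -> {RV P >-> R},
     skorokhod_solution F Y L U X Kp Km ->
     skorokhod_solution F Y L U X' Kp' Km' ->
     [/\ indistinguishable X X', indistinguishable Kp Kp' &
         indistinguishable Km Km']).
Proof.
have [eps eps0 sep] := hsep.
split; last first.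
  move=> X Kp Km X' Kp' Km' S S'.
  have E : {ae P, forall w, forall t, 0 <= t ->
      [/\ X t w = X' t w, Kp t w = Kp' t w & Km t w = Km' t w]}.
    have PS := skorokhod_solution_path hY hL hU S.
    have PS' := skorokhod_solution_path hY hL hU S'.
    apply: filterS3 sep PS PS' => w sepw Sw Sw'.
    apply: (skorokhod_path_unique _ Sw Sw') => t t0.
    by rewrite -subr_gt0 (lt_trans eps0)// sepw.
  by split; apply: filterS E => w E t t0; have [] := E t t0.
pose good := [set w | L 0 w <= Y 0 w <= U 0 w /\
  forall t, 0 <= t -> eps < U t w - L t w].
have ae_good : {ae P, forall w, good w} by apply: filterS2 h0 sep => w; split.
(* The complement of [good] is negligible, hence in [F 0] by completeness. *)
have F0good : F 0 good.
  have [sF _ _] := hF; rewrite -(setCK good) -setTD.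
  have [_ FC _] := sF 0 (lexx 0); have [compl _] := hFP.
  by apply: FC; apply: compl; exact: ae_good.
pose a t w := L t w - Y t w; pose b t w := Y t w - U t w.
have ra w : rcll_path (a ^~ w) by exact: rcll_pathB.
have rb w : rcll_path (b ^~ w) by exact: rcll_pathB.
have aa : adapted F a by exact: (adaptedB hF aL aY).
have ab : adapted F b by exact: (adaptedB hF aY aU).
have build (A B : R -> T -> R) : (forall w, rcll_path (A ^~ w)) ->
    (forall w, rcll_path (B ^~ w)) -> adapted F A -> adapted F B ->
    (forall w, good w -> forall t, 0 <= t -> A t w + B t w < - eps) ->
    exists K : R -> {RV P >-> R}, [/\ rcll K, adapted F K &
      forall w, good w -> forall t, 0 <= t ->
        K t w = pushing_lim (A ^~ w) (B ^~ w) t].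
  move=> rA rB aA aB AB.
  (* [rcll] speaks of every path, and off [good] the iterates may fail to converge; the indicator
     makes these paths 0. *)
  pose k t w := \1_good w * pushing_lim (A ^~ w) (B ^~ w) t.
  have ak : adapted F k.
    apply: (@adapted_cvg _ _ _ F
      (fun m t w => \1_good w * pushing (A ^~ w) (B ^~ w) m t)) => //.
      by move=> m; apply: adapted_indic => //; exact: adapted_pushing.
    move=> t w t0; rewrite /k indicE; have [gw|_] := boolP (w \in good).
      rewrite mul1r; under eq_fun do rewrite mul1r.
      apply: (cvg_pushing (rA w) (rB w) eps0) => //.
      by apply: AB; rewrite inE in gw.
    by rewrite mul0r; under eq_fun do rewrite mul0r; exact: cvg_cst.
  (* A process has a random variable at every real time, so time is truncated at 0. *)
  have mk t : measurable_fun setT (k (Num.max 0 t)).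
    by apply: (adapted_measurable hF ak); rewrite le_max lexx.
  have [K KE] := @process_of_measurable R d T P _ mk.
  exists K; split.
  - move=> w; apply: (@rcll_path_eq _ (k ^~ w)).
      by move=> t t0; rewrite KE max_r.
    rewrite /k indicE; have [gw|_] := boolP (w \in good).
      under eq_fun do rewrite mul1r.
      apply: (rcll_pushing_lim (rA w) (rB w) eps0).
      by apply: AB; rewrite inE in gw.
    by under eq_fun do rewrite mul0r; exact: rcll_path_cst.
  - move=> t t0 D mD; have := ak t t0 D mD.
    by congr (F t _); apply/funext => w; rewrite /preimage/= KE max_r.
  - by move=> w gw t t0; rewrite KE /k max_r// indicE mem_set// mul1r.
have [|Kp [rp ap KpE]] := build a b ra rb aa ab.
  by move=> w [_ sepw] t /sepw; rewrite /a /b; lra.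
have [|Km [rm am KmE]] := build b a rb ra ab aa.
  by move=> w [_ sepw] t /sepw; rewrite /a /b; lra.
have [X XE] : exists X : R -> {RV P >-> R},
    forall t w, X t w = Y t w + Kp t w - Km t w.
  apply: process_of_measurable => t.
  by apply: measurable_funB => //; apply: measurable_funD.
exists X, Kp, Km; apply: skorokhod_path_solution => //.
apply: filterS ae_good => w gw.
apply: skorokhod_path_eq
  (pushing_lim_skorokhod (hY w) (hL w) (hU w) gw.1 eps0 gw.2) => t t0.
by rewrite XE KpE// KmE.
Qed.
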